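(* Let $\varepsilon>0$, $u_0\in\mathcal V_{[0,1]}\setminus\{\mathbf 0,\mathbf 1\}$, and let $\tau_n\downarrow0$ with $\tau_n<\varepsilon$ be such that for every $t\ge0$ the limit $\hat u(t):=\lim_{n\to\infty}u^{[\tau_n]}_{\lceil t/\tau_n\rceil}$ exists and $\hat u$ is (together with some $\gamma$) a solution of mass-conserving double-obstacle AC flow on $[0,\infty)$ with $\hat u(0)=u_0$. Then for all $t>s\ge0$, \[ \mathrm{GL}_\varepsilon(\hat u(s)) - \mathrm{GL}_\varepsilon(\hat u(t)) \geq \frac{1}{2(t-s)} \|\hat u(s) -\hat u(t) \|_{\mathcal V}^2; \] in particular $t\mapsto\mathrm{GL}_\varepsilon(\hat u(t))$ is monotonically non-increasing.
   Context: $G=(V,E)$ is a finite, simple, connected, undirected graph with weights $\omega_{ij}=\omega_{ji}>0$ for $ij\in E$, $\omega_{ij}=0$ otherwise; $d_i=\sum_j\omega_{ij}$, $r\in[0,1]$ fixed. $\mathcal V$ = functions $V\to\mathbb R$ with $\langle u,v\rangle_{\mathcal V}=\sum_i u_iv_id_i^r$ and norm $\|\cdot\|_{\mathcal V}$; $\mathcal V_{[0,1]}$ = functions $V\to[0,1]$. $\mathcal E$ = functions on $E$ with $\langle\varphi,\phi\rangle_{\mathcal E}=\frac12\sum_{i,j}\varphi_{ij}\phi_{ij}\omega_{ij}$, $(\nabla u)_{ij}=u_j-u_i$ if $ij\in E$, else $0$. $(\Delta u)_i=d_i^{-r}\sum_j\omega_{ij}(u_i-u_j)$, $e^{-\tau\Delta}$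 its matrix exponential. $\mathbf 1$ all-ones, $\mathbf 0$ zero function; $\mathcal M(u)=\langle u,\mathbf 1\rangle_{\mathcal V}$; $\bar v=\mathcal M(v)/\mathcal M(\mathbf 1)$. Ginzburg–Landau functional: $\mathrm{GL}_\varepsilon(u)=\frac12\|\nabla u\|_{\mathcal E}^2+\frac1\varepsilon\sum_i d_i^rW(u_i)$ with $W(x)=\frac12x(1-x)$ for $x\in[0,1]$ and $W(x)=\infty$ otherwise. For $u\in\mathcal V_{[0,1]}$, $\mathcal B(u)$ = set of $\beta\in\mathcal V$ with $\beta_i\ge0$ if $u_i=0$, $\beta_i=0$ if $0<u_i<1$, $\beta_i\le0$ if $u_i=1$. Semi-discrete iterates with time step $\tau$, $\lambda=\tau/\varepsilon$ and initial state $u_0$: $u^{[\tau]}_0=u_0$ and for $m\ge0$, some $\beta^{[\tau]}_{m+1}\in\mathcal B(u^{[\tau]}_{m+1})$ with $u^{[\tau]}_{m+1} -e^{-\tau\Delta}u^{[\tau]}_m-\lambda u^{[\tau]}_{m+1}+\lambda\overline{u^{[\tau]}_{m+1}}\mathbf{1} =\lambda\beta^{[\tau]}_{m+1} -\lambda\overline{\beta^{[\tau]}_{m+1}}\mathbf{1}$ (for $\tau<\varepsilon$ the $u^{[\tau]}_m$ are uniquely determined). A pair $(u,\beta)$ is a solution to mass-conserving double-obstacle AC flow on $[0,\infty)$ if $u\in H^1_{loc}\cap C^0$, $u(t)\in\mathcal V_{[0,1]}$, and for a.e. $t$: $\varepsilon \frac{du}{dt} + \varepsilon\Delta u-u+\bar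 u\mathbf{1} = \beta - \bar\beta\mathbf{1}$, $\beta(t)\in\mathcal B(u(t))$. *)

(* Defs.v *)
From HB Require Import structures.
From mathcomp Require Import all_boot all_order all_algebra.
From mathcomp Require Import all_classical all_reals all_analysis.
Set Implicit Arguments. Unset Strict Implicit. Unset Printing Implicit Defensive.
Import Order.TTheory GRing.Theory Num.Theory.
Import numFieldNormedType.Exports.
Local Open Scope classical_set_scope.
Local Open Scope ring_scope.

Section GraphDefs.
Variables (R : realType) (V : finType) (w : V -> V -> R) (r : R).

(* weighted simple connected undirected graph: w i j > 0 iff ij is an edge *)
Definition simple_connected_weights : Prop :=
  (forall i j, w i j = w j i) /\ (forall i j, 0 <= w i j) /\
  (forall i, w i i = 0) /\ (forall i j, connect (fun a b => 0 < w a b) i j).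

Definition deg (i : V) : R := \sum_(j : V) w i j.

Definition degr (i : V) : R := powR (deg i) r.

Definition ipV (u v : V -> R) : R := \sum_(i : V) u i * v i * degr i.
Definition normV2 (u : V -> R) : R := ipV u u.

Definition one_fun : V -> R := fun _ => 1.
Definition mass (u : V -> R) : R := ipV u one_fun.
Definition avg (u : V -> R) : R := mass u / mass one_fun.

Definition grad (u : V -> R) (i j : V) : R := if 0 < w i j then u j - u i else 0.
Definition normE2 (phi : V -> V -> R) : R :=
  2^-1 * \sum_(i : V) \sum_(j : V) phi i j ^+ 2 * w i j.

Definition Lap (u : V -> R) : V -> R :=
  fun i => powR (deg i) (- r) * \sum_(j : V) w i j * (u i - u j).

Definition expLap (tau : R) (u : V -> R) : V -> R :=
  fun i => limn (fun N => \sum_(0 <= k < N) ((- tau) ^+ k / (k`!)%:R * iter k Lap u i)).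

Definition Wpot (x : R) : \bar R :=
  if (0 <= x) && (x <= 1) then (2^-1 * (x * (1 - x)))%:E else +oo%E.

Definition GL (eps : R) (u : V -> R) : \bar R :=
  ((2^-1 * normE2 (grad u))%:E + (eps^-1)%:E * \sum_(i : V) ((degr i)%:E * Wpot (u i)))%E.

Definition in01 (u : V -> R) : Prop := forall i, 0 <= u i <= 1.

Definition inB (u beta : V -> R) : Prop :=
  forall i, (u i = 0 -> 0 <= beta i) /\ (0 < u i < 1 -> beta i = 0) /\
            (u i = 1 -> beta i <= 0).

Definition semi_discrete (eps tau : R) (u0 : V -> R) (U : nat -> V -> R) : Prop :=
  U 0%N = u0 /\
  forall m : nat, in01 (U m.+1) /\
    exists beta : V -> R, inB (U m.+1) beta /\
      forall i, U m.+1 i - expLap tau (U m) i - (tau / eps) * U m.+1 i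
                + (tau / eps) * avg (U m.+1)
              = (tau / eps) * beta i - (tau / eps) * avg beta.

Definition I0 (T : R) : set R := `[0, T].

(* scalar f is in H^1_loc([0,oo)) with weak derivative g: g is locally L^2 on
   [0,oo) and f(t) = f(0) + int_0^t g for t >= 0 *)
Definition H1loc_wderiv (f g : R -> R) : Prop :=
  forall T : R, 0 <= T ->
    measurable_fun (I0 T) g /\
    (\int[lebesgue_measure]_(s in I0 T) ((g s) ^+ 2)%:E < +oo)%E /\
    (\int[lebesgue_measure]_(s in I0 T) (g s)%:E = (f T - f 0)%:E)%E.

Definition AC_solution (eps : R) (u beta : R -> V -> R) : Prop :=
  exists du : R -> V -> R,
    (forall i, H1loc_wderiv (fun t => u t i) (fun t => du t i)) /\
    (forall i, {within `[0, +oo[, continuous (fun t => u t i)}) /\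
    (forall t, 0 <= t -> in01 (u t)) /\
    {ae lebesgue_measure, forall t, 0 <= t ->
       inB (u t) (beta t) /\
       forall i, eps * du t i + eps * Lap (u t) i - u t i + avg (u t)
                 = beta t i - avg (beta t)}.

End GraphDefs.

(* Main.v *)
(* With A = e^{-tau Lap} and lam = tau / eps, the functional
   H(u) = lam <u, 1 - u> + <u, u - A u> decreases along the semi-discrete
   iterates, by at least (1 - lam) |u_m - u_{m+1}|^2 at each step.  Summing over
   the roughly (t - s) / tau steps between times s and t and applying the
   Cauchy-Schwarz inequality bounds |u_m - u_k|^2 by (t - s) / tau times the drop
   of H.  Since H / (2 tau) converges to GL uniformly as tau tends to 0, the
   estimate follows in the limit; the differential equation satisfied by the
   limit is never needed. *)
Require Import Defs.
From HB Require Import structures.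
From mathcomp Require Import all_boot all_order all_algebra.
From mathcomp Require Import all_classical all_reals all_analysis.
From mathcomp Require Import ring lra.
Set Implicit Arguments.
Unset Strict Implicit.
Unset Printing Implicit Defensive.
Import Order.TTheory GRing.Theory Num.Theory.
Import numFieldNormedType.Exports.
Local Open Scope classical_set_scope.
Local Open Scope ring_scope.

(** * The degree-weighted inner product on vertex functions *)

Section InnerProduct.
Variables (R : realType) (V : finType) (w : V -> V -> R) (r : R).
Implicit Types u v : V -> R.

Lemma degr_ge0 i : 0 <= degr w r i.
Proof. exact: powR_ge0. Qed.

Lemma ipVC u v : ipV w r u v = ipV w r v u.
Proof. by apply: eq_bigr => i _; rewrite [u i * _]mulrC. Qed.

Lemma normV2_ge0 u : 0 <= normV2 w r u.
Proof.
by apply: sumr_ge0 => i _; rewrite mulr_ge0 ?degr_ge0// -expr2 sqr_ge0.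
Qed.

Lemma massE u : mass w r u = \sum_i u i * degr w r i.
Proof. by apply: eq_bigr => i _; rewrite /Defs.one_fun mulr1. Qed.

(** If the total mass is zero, every weight [degr] vanishes and so does the mass of [u]; the
    identity thus survives the division by zero in [avg]. *)
Lemma mass_one_avg u : mass w r (@Defs.one_fun R V) * avg w r u = mass w r u.
Proof.
rewrite /avg mulrC.
have [m0|m0] := eqVneq (mass w r (@Defs.one_fun R V)) 0; last first.
  by rewrite mulfVK.
rewrite m0 mulr0 massE; apply/esym/big1 => i _.
suff -> : degr w r i = 0 by rewrite mulr0.
move/eqP: m0; rewrite massE psumr_eq0 => [|j _]; last first.
  by rewrite mul1r degr_ge0.
by move=> /allP/(_ i (mem_index_enum _))/=; rewrite /Defs.one_fun mul1r => /eqP.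
Qed.

Lemma sqr_le_normV2 u : (forall i, 0 < degr w r i) ->
  forall i, u i ^+ 2 <= (\sum_j (degr w r j)^-1) * normV2 w r u.
Proof.
move=> d0 i.
have di := d0 i.
rewrite (_ : u i ^+ 2 = (degr w r i)^-1 * (u i * u i * degr w r i)); last first.
  by field; rewrite gt_eqF.
apply: ler_pM.
- by rewrite invr_ge0 ltW.
- by rewrite mulr_ge0 ?degr_ge0// -expr2 sqr_ge0.
- rewrite (bigD1 i)//= lerDl sumr_ge0// => j _; by rewrite invr_ge0 ltW.
- rewrite /normV2 /ipV (bigD1 i)//= lerDl sumr_ge0// => j _.
  by rewrite mulr_ge0 ?degr_ge0// -expr2 sqr_ge0.
Qed.

(** The difference of the two sides is the squared norm of [u - p v]. Divided by [p (p + 1)], this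
    is the Cauchy-Schwarz step that adds one increment [v] to a sum [u] of [p] increments. *)
Lemma normV2D (p : R) u v : 0 <= p ->
  p * normV2 w r (fun i => u i + v i) <=
  (p + 1) * (normV2 w r u + p * normV2 w r v).
Proof.
move=> p0; rewrite /normV2 /ipV mulr_sumr [p * \sum__ _]mulr_sumr -big_split/=.
rewrite mulr_sumr; apply: ler_sum => i _.
rewrite -subr_ge0 (_ : _ - _ = (u i - p * v i) ^+ 2 * degr w r i).
  by rewrite mulr_ge0 ?sqr_ge0 ?degr_ge0.
by ring.
Qed.

Lemma cvg_sum_fin (T : Type) (F : set_system T) (FF : Filter F)
    (f : V -> T -> R) (l : V -> R) :
  (forall i, f i t @[t --> F] --> l i) ->
  \sum_i f i t @[t --> F] --> \sum_i l i.
Proof. by move=> fl; apply: cvg_big => //; exact: add_continuous. Qed.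

Lemma cvg_ipV (T : Type) (F : set_system T) (FF : Filter F)
    (f g : T -> V -> R) (u v : V -> R) :
  (forall i, f t i @[t --> F] --> u i) -> (forall i, g t i @[t --> F] --> v i) ->
  ipV w r (f t) (g t) @[t --> F] --> ipV w r u v.
Proof.
move=> fu gv; apply: (@cvg_sum_fin _ _ _ (fun i t => f t i * g t i * degr w r i)).
by move=> i; apply: cvgMr_tmp; apply: cvgM.
Qed.

End InnerProduct.

(** * The graph Laplacian and its Dirichlet form *)

Section Laplacian.
Variables (R : realType) (V : finType) (w : V -> V -> R) (r : R).
Hypotheses (w_sym : forall i j, w i j = w j i) (w_ge0 : forall i j, 0 <= w i j).
Implicit Types u v : V -> R.

Lemma deg_ge0 i : 0 <= deg w i.
Proof. exact: sumr_ge0. Qed.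

Lemma deg_eq0_weight i j : deg w i = 0 -> w i j = 0.
Proof.
move=> /eqP; rewrite psumr_eq0// => /allP/(_ j (mem_index_enum _))/=.
by move/eqP.
Qed.

Lemma degr_eq0_deg i : degr w r i = 0 -> deg w i = 0.
Proof. by move=> /eqP; rewrite powR_eq0 => /andP[/eqP]. Qed.

(* At a vertex of degree 0 both sides vanish, whatever the value of 0 to the
   power -r. *)
Lemma degr_Lap u i : degr w r i * Lap w r u i = \sum_j w i j * (u i - u j).
Proof.
rewrite /Lap mulrA; have [d0|d0] := eqVneq (deg w i) 0.
  by rewrite !big1 ?mulr0// => j _; rewrite deg_eq0_weight ?mul0r.
by rewrite /degr powRN mulfV ?mul1r// powR_eq0 (negPf d0).
Qed.

Lemma ipV_LapE u v :
  ipV w r (Lap w r u) v = \sum_i \sum_j w i j * ((u i - u j) * v i).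
Proof.
apply: eq_bigr => i _.
rewrite mulrAC [Lap _ _ _ _ * _]mulrC degr_Lap mulr_suml.
by apply: eq_bigr => j _; rewrite mulrA.
Qed.

(** Swapping [i] and [j] turns the terms in [v j] into those in [v i], by symmetry of the weights;
    hence the factor 1/2. The symmetry of [Lap] and the Dirichlet energy can be read off this
    form. *)
Lemma ipV_Lap_grad u v : ipV w r (Lap w r u) v =
  2^-1 * \sum_i \sum_j w i j * ((u i - u j) * (v i - v j)).
Proof.
have E : \sum_i \sum_j w i j * ((u i - u j) * (v i - v j)) =
    \sum_i \sum_j w i j * ((u i - u j) * v i) +
    \sum_i \sum_j w i j * ((u i - u j) * v i).
  rewrite [X in _ = _ + X]exchange_big/= -big_split/=; apply: eq_bigr => i _.
  rewrite -big_split/=; apply: eq_bigr => j _; rewrite (w_sym j i).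
  by ring.
by rewrite E -ipV_LapE; field.
Qed.

Lemma ipV_Lap_sym u v : ipV w r (Lap w r u) v = ipV w r u (Lap w r v).
Proof.
rewrite (ipVC w r u) !ipV_Lap_grad; congr (_ * _).
by apply: eq_bigr => i _; apply: eq_bigr => j _; rewrite [(u i - _) * _]mulrC.
Qed.

Lemma ipV_iter_Lap_sym k u v :
  ipV w r (iter k (Lap w r) u) v = ipV w r u (iter k (Lap w r) v).
Proof.
elim: k u v => //= k IH u v.
by rewrite ipV_Lap_sym IH -iterSr.
Qed.

Lemma Lap_one i : Lap w r (@Defs.one_fun R V) i = 0.
Proof.
by rewrite /Lap big1 ?mulr0// => j _; rewrite /Defs.one_fun subrr mulr0.
Qed.

Lemma normE2_grad u : normE2 w (grad w u) = ipV w r u (Lap w r u).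
Proof.
rewrite ipVC ipV_Lap_grad; congr (_ * _); apply: eq_bigr => i _.
apply: eq_bigr => j _; rewrite /grad; case: ifPn => [_|]; first by ring.
rewrite -leNgt => w0; have -> : w i j = 0 by apply/le_anti; rewrite w0 w_ge0.
by rewrite !(mul0r, mulr0).
Qed.

Lemma cvg_Lap (T : Type) (F : set_system T) (FF : Filter F)
    (f : T -> V -> R) u : (forall i, f t i @[t --> F] --> u i) ->
  forall i, Lap w r (f t) i @[t --> F] --> Lap w r u i.
Proof.
move=> fu i; apply: cvgM; first exact: cvg_cst.
apply: (@cvg_sum_fin _ _ _ _ _ (fun j t => w i j * (f t i - f t j))) => j.
by apply: cvgM; [exact: cvg_cst|exact: cvgB].
Qed.

(** No edge leaves a vertex of degree 0, so the path from [i] to [j] is empty and [j] is [i]. *)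
Lemma degr_eq0_all i : (forall a b, connect (fun a b => 0 < w a b) a b) ->
  degr w r i = 0 -> forall j, degr w r j = 0.
Proof.
move=> conn di j; case/connectP: (conn i j) => -[_ ->//|k p] /= /andP[].
by rewrite (deg_eq0_weight _ (degr_eq0_deg di)) ltxx.
Qed.

(** A bound on the operator norm of [Lap] for the supremum norm; summing over the rows avoids taking
    a maximum. *)
Definition Lap_bound : R := \sum_i powR (deg w i) (- r) * (2 * deg w i).

Lemma Lap_bound_ge0 : 0 <= Lap_bound.
Proof.
by apply: sumr_ge0 => i _; rewrite mulr_ge0 ?powR_ge0// mulr_ge0// deg_ge0.
Qed.

Lemma normr_Lap_le u (K : R) : (forall i, `|u i| <= K) ->
  forall i, `|Lap w r u i| <= Lap_bound * K.
Proof.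
move=> uK i; have K0 : 0 <= K by apply: le_trans (uK i).
rewrite /Lap normrM ger0_norm ?powR_ge0//.
apply: (@le_trans _ _ (powR (deg w i) (- r) * (2 * deg w i) * K)).
  rewrite -mulrA ler_wpM2l ?powR_ge0// (le_trans (ler_norm_sum _ _ _))//.
  rewrite /deg mulr_sumr mulr_suml; apply: ler_sum => j _.
  rewrite normrM (ger0_norm (w_ge0 _ _)) (mulrC 2) -mulrA ler_wpM2l//.
  rewrite (le_trans (ler_normB _ _))// mulrDl mul1r lerD//.
rewrite ler_wpM2r// /Lap_bound [leRHS](bigD1 i)//= lerDl sumr_ge0// => j _.
by rewrite mulr_ge0 ?powR_ge0// mulr_ge0// deg_ge0.
Qed.

Lemma normr_iter_Lap_le u (K : R) k : (forall i, `|u i| <= K) ->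
  forall i, `|iter k (Lap w r) u i| <= Lap_bound ^+ k * K.
Proof.
move=> uK; elim: k => [|k IH] i; first by rewrite mul1r uK.
by rewrite exprS -mulrA; apply: normr_Lap_le.
Qed.

(** * The heat operator for small time steps *)

Section HeatOperator.
Variable tau : R.
Hypotheses (tau_ge0 : 0 <= tau) (tau_small : tau * Lap_bound <= 2^-1).
Local Notation A := (expLap w r tau).
Local Notation x := (tau * Lap_bound).

Let heat_term u i k : R := (- tau) ^+ k / (k`!)%:R * iter k (Lap w r) u i.

Let x_ge0 : 0 <= x.
Proof. by rewrite mulr_ge0// Lap_bound_ge0. Qed.

(** Dropping the factorial leaves a geometric majorant, whose ratio is at most 1/2 by
    [tau_small]. *)
Lemma normr_heat_term u (K : R) i k : (forall i, `|u i| <= K) ->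
  `|heat_term u i k| <= K * x ^+ k.
Proof.
move=> uK; have K0 : 0 <= K by apply: le_trans (uK i).
rewrite /heat_term !normrM normrX normrN (ger0_norm tau_ge0) normfV normr_nat.
rewrite exprMn mulrCA mulrC [K * _]mulrC.
apply: (@le_trans _ _ (tau ^+ k * `|iter k (Lap w r) u i|)).
  rewrite mulrC ler_wpM2r// ler_piMr ?exprn_ge0//.
  by rewrite invf_le1 ?ltr0n ?fact_gt0// ler1n fact_gt0.
by rewrite ler_wpM2l ?exprn_ge0// normr_iter_Lap_le.
Qed.

Lemma sum_powers_le2 N : \sum_(0 <= k < N) x ^+ k <= 2.
Proof.
elim: N => [|N IH]; first by rewrite big_geq.
rewrite big_nat_recl// expr0.
under eq_bigr do rewrite exprS.
rewrite -mulr_sumr.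
have : x * \sum_(0 <= k < N) x ^+ k <= 2^-1 * 2.
  by apply: ler_pM => //; apply: sumr_ge0 => k _; rewrite exprn_ge0.
by lra.
Qed.

Lemma is_cvg_expLap u i :
  cvgn (fun N => \sum_(0 <= k < N) heat_term u i k).
Proof.
pose K := \sum_j `|u j|.
have uK j : `|u j| <= K by rewrite /K (bigD1 j)//= lerDl sumr_ge0.
have K0 : 0 <= K by apply: sumr_ge0.
apply: (@normed_cvg _ _ (heat_term u i)).
apply: (@series_le_cvg _ _ (geometric K x)) => [k|k|k|].
- exact: normr_ge0.
- by rewrite geometric_ge0.
- exact: normr_heat_term.
- by apply: is_cvg_geometric_series; rewrite ger0_norm// (le_lt_trans tau_small)// invf_lt1 ?ltr1n.
Qed.

Lemma cvg_expLap u i :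
  (fun N => \sum_(0 <= k < N) heat_term u i k) @ \oo --> A u i.
Proof. exact: is_cvg_expLap. Qed.

(** The first two terms of the series are [u] and [- tau * Lap u]; the tail is at most [K * x ^+ 2]
    times a geometric sum bounded by 2. *)
Lemma expLap_second_order u (K : R) : (forall i, `|u i| <= K) ->
  forall i, `|A u i - u i + tau * Lap w r u i| <= 2 * K * x ^+ 2.
Proof.
move=> uK i; have K0 : 0 <= K by apply: le_trans (uK i).
have cv : (fun N => `|\sum_(0 <= k < N) heat_term u i k - u i + tau * Lap w r u i|)
    @ \oo --> `|A u i - u i + tau * Lap w r u i|.
  apply: cvg_norm; apply: cvgD; last exact: cvg_cst.
  by apply: cvgB; [exact: cvg_expLap|exact: cvg_cst].
rewrite -(cvg_lim _ cv)//; apply: limr_le; first by apply/cvg_ex; eexists; exact: cv.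
(* Partial sums with at least two terms allow the orders 0 and 1 to be split off. *)
exists 2%N => // -[//|[//|N]] _ /=.
rewrite big_nat_recl// big_nat_recl//=.
have -> : heat_term u i 0%N = u i by rewrite /heat_term expr0 fact0 invr1 !mul1r.
have -> : heat_term u i 1%N = - (tau * Lap w r u i).
  by rewrite /heat_term expr1 factS fact0 invr1 mulr1 mulNr.
set S := \sum_(_ <= _ < _) _.
rewrite (_ : _ + _ = S); last by ring.
apply: (@le_trans _ _ (\sum_(0 <= k < N) K * x ^+ 2 * x ^+ k)).
  rewrite (le_trans (ler_norm_sum _ _ _))//; apply: ler_sum => k _.
  by rewrite -mulrA -exprD; exact: normr_heat_term.
rewrite -mulr_sumr mulrC -mulrA ler_wpM2r ?sum_powers_le2//.
by rewrite mulr_ge0// exprn_ge0.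
Qed.

Lemma expLap_first_order u (K : R) : (forall i, `|u i| <= K) ->
  forall i, `|A u i - u i| <= 2 * K * x.
Proof.
move=> uK i; have K0 : 0 <= K by apply: le_trans (uK i).
have := expLap_second_order uK i; have := normr_Lap_le uK i => H1 H2.
have -> : A u i - u i = (A u i - u i + tau * Lap w r u i) - tau * Lap w r u i.
  by ring.
rewrite (le_trans (ler_normB _ _))// normrM (ger0_norm tau_ge0).
have : tau * `|Lap w r u i| <= tau * (Lap_bound * K) by rewrite ler_wpM2l.
have : K * x * x <= K * x * 2^-1 by rewrite ler_wpM2l// mulr_ge0.
by move: H2; rewrite expr2; lra.
Qed.

(** Each partial sum is a polynomial in the symmetric operator [Lap], and symmetry passes to the
    limit. *)
Lemma ipV_expLap_sym u v : ipV w r (A u) v = ipV w r u (A v).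
Proof.
pose S u N i : R := \sum_(0 <= k < N) heat_term u i k.
have Sl : (fun N => ipV w r (S u N) v) @ \oo --> ipV w r (A u) v.
  by apply: cvg_ipV => i; [exact: cvg_expLap|exact: cvg_cst].
have Sr : (fun N => ipV w r u (S v N)) @ \oo --> ipV w r u (A v).
  by apply: cvg_ipV => i; [exact: cvg_cst|exact: cvg_expLap].
have E : (fun N => ipV w r (S u N) v) = (fun N => ipV w r u (S v N)).
  apply/funext => N; rewrite /ipV /S.
  under eq_bigr do rewrite 2!mulr_suml.
  under [RHS]eq_bigr do rewrite mulr_sumr mulr_suml.
  rewrite exchange_big [RHS]exchange_big/=; apply: eq_bigr => k _.
  set c := (- tau) ^+ k / (k`!)%:R.
  transitivity (c * ipV w r (iter k (Lap w r) u) v).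
    by rewrite mulr_sumr; apply: eq_bigr => i _; rewrite /heat_term -/c !mulrA.
  rewrite ipV_iter_Lap_sym mulr_sumr; apply: eq_bigr => i _.
  by rewrite /heat_term -/c; ring.
by rewrite -(cvg_lim _ Sl)// -(cvg_lim _ Sr)// E.
Qed.

Lemma expLap_one i : A (@Defs.one_fun R V) i = 1.
Proof.
have Ak k : iter k.+1 (Lap w r) (@Defs.one_fun R V) = fun=> 0.
  elim: k => [|k IH]; apply/funext => j; first exact: Lap_one.
  rewrite iterS IH /Lap big1 ?mulr0// => l _; by rewrite subrr mulr0.
have cv := @cvg_expLap (@Defs.one_fun R V) i.
rewrite -(cvg_lim _ cv)//; apply: lim_near_cst => //.
exists 1%N => // -[//|N] _ /=; rewrite big_nat_recl// big1 ?addr0.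
  by rewrite /heat_term expr0 fact0 invr1 !mul1r.
by move=> k _; rewrite /heat_term Ak mulr0.
Qed.

Lemma mass_expLap u : mass w r (A u) = mass w r u.
Proof.
rewrite /mass ipV_expLap_sym; congr ipV; apply/funext => i; exact: expLap_one.
Qed.

Lemma expLapB u v i : A (fun j => u j - v j) i = A u i - A v i.
Proof.
have LapB k : iter k (Lap w r) (fun j => u j - v j) =
    fun j => iter k (Lap w r) u j - iter k (Lap w r) v j.
  elim: k => //= k ->; apply/funext => j; rewrite /Lap -mulrBr -sumrB.
  by congr (_ * _); apply: eq_bigr => l _; ring.
have cB : (fun N => \sum_(0 <= k < N) heat_term u i k -
    \sum_(0 <= k < N) heat_term v i k) @ \oo --> A u i - A v i.
  by apply: cvgB; exact: cvg_expLap.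
rewrite -(cvg_lim _ cB)// -(cvg_lim _ (@cvg_expLap (fun j => u j - v j) i))//.
congr (lim (_ @ \oo)); apply/funext => N; rewrite -sumrB.
by apply: eq_bigr => k _; rewrite /heat_term LapB mulrBr.
Qed.

(* For small tau, positivity already follows from e^{-tau Lap} being close to
   the identity, so the semigroup property is not needed. *)
Lemma expLap_psd : (forall i, 0 < degr w r i) ->
  2 * x * (\sum_i degr w r i) * (\sum_i (degr w r i)^-1) <= 1 ->
  forall u, 0 <= ipV w r u (A u).
Proof.
move=> d0 small u.
set c := \sum_i (degr w r i)^-1; set D := \sum_i degr w r i.
have c0 : 0 <= c by apply: sumr_ge0 => i _; rewrite invr_ge0 ltW.
(* A supremum bound on [u] whose square is a multiple of the squared norm: the first-order estimate
   then bounds the pairing of [u] with [A u - u] by [2 * x * D * c] times that squared norm. *)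
pose K := Num.sqrt (c * normV2 w r u).
have K2 : K ^+ 2 = c * normV2 w r u.
  by rewrite sqr_sqrtr// mulr_ge0// normV2_ge0.
have uK i : `|u i| <= K.
  by rewrite -sqrtr_sqr ler_wsqrtr// sqr_le_normV2.
have -> : ipV w r u (A u) = normV2 w r u + ipV w r u (fun i => A u i - u i).
  by rewrite /normV2 /ipV -big_split/=; apply: eq_bigr => i _; ring.
have H : `|ipV w r u (fun i => A u i - u i)| <= normV2 w r u.
  rewrite (le_trans (ler_norm_sum _ _ _))//.
  apply: (@le_trans _ _ (\sum_i K * (2 * K * x) * degr w r i)).
    apply: ler_sum => i _; rewrite !normrM (ger0_norm (degr_ge0 _ _ _)).
    by rewrite ler_wpM2r ?degr_ge0// ler_pM// expLap_first_order.
  rewrite -mulr_sumr -/D.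
  have -> : K * (2 * K * x) * D = 2 * x * D * K ^+ 2 by ring.
  by rewrite K2 (mulrA _ c) ler_piMl// normV2_ge0.
by move: H; rewrite ler_norml; lra.
Qed.

End HeatOperator.

(** * Dissipation along the semi-discrete scheme *)

Section Scheme.
Variables (eps tau : R).
Hypotheses (eps_gt0 : 0 < eps) (tau_gt0 : 0 < tau).
Hypothesis tau_small : tau * Lap_bound <= 2^-1.
Local Notation A := (expLap w r tau).
Local Notation lam := (tau / eps).

(* This is (up to the factor 2 tau) a discrete version of GL: expanding the
   exponential gives lyapunov u = 2 tau GL(u) + O(tau^2), uniformly on
   [0,1]-valued u. *)
Definition lyapunov u : R :=
  lam * ipV w r u (fun i => 1 - u i) + ipV w r u (fun i => u i - A u i).

(** [GL] with the infinite branch of the potential replaced by its polynomial: real-valued and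
    continuous, hence suited to limits. *)
Definition energy u : R :=
  2^-1 * ipV w r u (Lap w r u) + eps^-1 * (2^-1 * ipV w r u (fun i => 1 - u i)).

Lemma GL_energy u : in01 u -> GL w r eps u = (energy u)%:E.
Proof.
move=> u01; rewrite /GL normE2_grad /energy.
under eq_bigr do rewrite /Wpot u01 -EFinM.
rewrite sumEFin -EFinM -EFinD; congr (_ + _ * _)%:E.
by rewrite mulr_sumr; apply: eq_bigr => i _; ring.
Qed.

(** The potential terms cancel exactly, leaving the pairing of [u] with the second-order remainder
    of the heat operator. *)
Lemma lyapunov_energy u : in01 u ->
  `|lyapunov u - 2 * tau * energy u| <=
  2 * (\sum_i degr w r i) * Lap_bound ^+ 2 * tau ^+ 2.
Proof.
move=> u01; have u1 i : `|u i| <= 1.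
  by case/andP: (u01 i) => ? ?; rewrite ger0_norm.
have -> : lyapunov u - 2 * tau * energy u =
    \sum_i - (u i * (A u i - u i + tau * Lap w r u i) * degr w r i).
  rewrite /lyapunov /energy.
  transitivity (ipV w r u (fun i => u i - A u i) - tau * ipV w r u (Lap w r u)).
    by field; rewrite gt_eqF.
  by rewrite /ipV mulr_sumr -sumrB; apply: eq_bigr => i _; ring.
rewrite (le_trans (ler_norm_sum _ _ _))//.
rewrite (_ : _ * tau ^+ 2 =
    \sum_i 2 * 1 * (tau * Lap_bound) ^+ 2 * degr w r i); last first.
  by rewrite -mulr_sumr; ring.
apply: ler_sum => i _; rewrite normrN !normrM (ger0_norm (degr_ge0 _ _ _)).
rewrite ler_wpM2r ?degr_ge0// -[leRHS]mul1r ler_pM//.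
by apply: expLap_second_order => //; exact: ltW.
Qed.

Hypothesis degr_gt0 : forall i, 0 < degr w r i.
Hypothesis tau_psd :
  2 * (tau * Lap_bound) * (\sum_i degr w r i) * (\sum_i (degr w r i)^-1) <= 1.

(* The scheme says that A u = (1 - lam) v - lam beta + const, so convexity of
   z |-> <z, A z> at u, mass conservation and <u - v, beta> >= 0 suffice. *)
Lemma lyapunov_step u v beta : in01 u -> in01 v -> inB v beta ->
  (forall i, v i - A u i - lam * v i + lam * avg w r v =
             lam * beta i - lam * avg w r beta) ->
  (1 - lam) * normV2 w r (fun i => u i - v i) <= lyapunov u - lyapunov v.
Proof.
move=> u01 v01 vB step.
have Au i : A u i = (1 - lam) * v i - lam * beta i +
    lam * (avg w r v + avg w r beta) by move: (step i); lra.
(* Pairing the scheme with the constant 1 cancels both averages against their functions, and [A]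
   preserves mass. *)
have mass_uv : mass w r u = mass w r v.
  rewrite -(mass_expLap (ltW tau_gt0) tau_small).
  transitivity ((1 - lam) * mass w r v - lam * mass w r beta +
      lam * (avg w r v + avg w r beta) * mass w r (@Defs.one_fun R V)).
    rewrite /mass /ipV !(mulr_sumr, =^~ sumrN, =^~ big_split)/=.
    by apply: eq_bigr => i _; rewrite Au /Defs.one_fun; ring.
  have := mass_one_avg w r v; have := mass_one_avg w r beta.
  by move: (mass w r v) (mass w r beta) => a b <- <-; ring.
have lyapE z : lyapunov z = lam * mass w r z + (1 - lam) * normV2 w r z - ipV w r z (A z).
  rewrite /lyapunov /mass /normV2 /ipV !(mulr_sumr, =^~ sumrN, =^~ big_split)/=.
  by apply: eq_bigr => i _; rewrite /Defs.one_fun; ring.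
(* Convexity: up to symmetry of [A], this is the gap at [v] between the quadratic form and its
   tangent at [u]. *)
have psd : 0 <= ipV w r v (A v) - ipV w r v (A u) - (ipV w r u (A v) - ipV w r u (A u)).
  have -> : ipV w r v (A v) - ipV w r v (A u) - (ipV w r u (A v) - ipV w r u (A u)) =
      ipV w r (fun i => v i - u i) (A (fun i => v i - u i)).
    rewrite /ipV -!sumrB; apply: eq_bigr => i _.
    by rewrite (expLapB (ltW tau_gt0) tau_small); ring.
  exact: expLap_psd (ltW tau_gt0) tau_small _ _ _.
have sym : ipV w r u (A v) = ipV w r v (A u).
  by rewrite -(ipV_expLap_sym (ltW tau_gt0) tau_small) ipVC.
have inner : ipV w r v (A u) - ipV w r u (A u) =
    (1 - lam) * (normV2 w r v - ipV w r u v) +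
    lam * (avg w r v + avg w r beta) * (mass w r v - mass w r u) +
    lam * ipV w r (fun i => u i - v i) beta.
  rewrite /mass /normV2 /ipV.
  rewrite !(mulr_sumr, =^~ sumrN, =^~ big_split)/=.
  by apply: eq_bigr => i _; rewrite Au /Defs.one_fun; ring.
(* Pointwise, [u - v] and [beta] are both nonnegative where [v] is 0 and both nonpositive where [v]
   is 1; in between [beta] vanishes. *)
have obstacle : 0 <= lam * ipV w r (fun i => u i - v i) beta.
  apply: mulr_ge0; first by rewrite ltW// divr_gt0.
  apply: sumr_ge0 => i _.
  rewrite mulr_ge0 ?degr_ge0//.
  have [v0 [vm v1]] := vB i; have /andP[u0 u1] := u01 i.
  have /andP[] := v01 i; rewrite le_eqVlt => /orP[/eqP v0'|vgt].
    by move=> _; rewrite -v0' subr0 mulr_ge0// v0.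
  rewrite le_eqVlt => /orP[/eqP v1'|vlt].
    by rewrite v1' mulr_le0// ?subr_le0// v1.
  by rewrite vm ?mulr0// vgt.
have -> : normV2 w r (fun i => u i - v i) =
    normV2 w r u - 2 * ipV w r u v + normV2 w r v.
  rewrite /normV2 /ipV !(mulr_sumr, =^~ sumrN, =^~ big_split)/=.
  by apply: eq_bigr => i _; ring.
move: inner psd; rewrite !lyapE sym mass_uv subrr mulr0 addr0.
by lra.
Qed.

Hypothesis tau_lt_eps : tau < eps.

(** Induction on the number of steps, with [normV2D] joining the last increment to the earlier ones.
    Monotonicity is kept alongside so that [p] may later be replaced by a larger real number. *)
Lemma lyapunov_steps u0 (U : nat -> V -> R) : in01 u0 ->
  semi_discrete w r eps tau u0 U -> forall m p,
  lyapunov (U (m + p)%N) <= lyapunov (U m) /\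
  (1 - lam) * normV2 w r (fun i => U m i - U (m + p)%N i) <=
    p%:R * (lyapunov (U m) - lyapunov (U (m + p)%N)).
Proof.
move=> u01 [U0 US].
have U01 m : in01 (U m) by case: m => [|m]; [rewrite U0|case: (US m)].
have lam1 : 0 <= 1 - lam by rewrite subr_ge0 ler_pdivrMr// mul1r ltW.
have step m : (1 - lam) * normV2 w r (fun i => U m i - U m.+1 i) <=
    lyapunov (U m) - lyapunov (U m.+1).
  by have [U1 [beta [UB e]]] := US m; exact: lyapunov_step UB e.
move=> m; elim=> [|p [le1 IH]].
  by rewrite addn0 subrr mulr0 /normV2 /ipV big1 ?mulr0// => i _; rewrite subrr !mul0r.
have := step (m + p)%N; rewrite -addnS => st.
have st0 : 0 <= (1 - lam) * normV2 w r (fun i => U (m + p)%N i - U (m + p.+1)%N i).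
  by rewrite mulr_ge0// normV2_ge0.
split; first by lra.
(* The first step is treated apart, since the general one cancels a factor equal to the number of
   earlier steps. *)
case: p le1 IH st st0 => [|p] le1 IH st st0.
  by move: st; rewrite addn0 mul1r.
set P : R := p.+1%:R.
have P0 : 0 < P by rewrite ltr0n.
have := @normV2D R V w r P (fun i => U m i - U (m + p.+1)%N i)
  (fun i => U (m + p.+1)%N i - U (m + p.+2)%N i) (ltW P0).
rewrite (_ : (fun i => _ - _ + (_ - _)) = (fun i => U m i - U (m + p.+2)%N i)); last first.
  by apply/funext => i; ring.
move=> /(ler_wpM2l lam1) Nle.
have PIH := ler_wpM2l (addr_ge0 (ltW P0) ler01) IH.
have Pst := ler_wpM2l (mulr_ge0 (addr_ge0 (ltW P0) ler01) (ltW P0)) st.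
rewrite -(ler_pM2l P0) -(natr1 p.+1) -/P.
by move: Nle PIH Pst; lra.
Qed.

End Scheme.

(** * Passage to the limit in the time step *)

Lemma cvg_energy (eps : R) (T : Type) (F : set_system T) (FF : Filter F)
    (f : T -> V -> R) u : (forall i, f t i @[t --> F] --> u i) ->
  energy eps (f t) @[t --> F] --> energy eps u.
Proof.
move=> fu; apply: cvgD; apply: cvgM; try exact: cvg_cst.
  by apply: cvg_ipV => //; exact: cvg_Lap.
apply: cvgM; first exact: cvg_cst.
by apply: cvg_ipV => // i; apply: cvgB => //; exact: cvg_cst.
Qed.

(** The summed estimate is multiplied by [tau], and the Lyapunov drop is traded for [2 * tau] times
    the energy drop. The two errors of order [tau ^+ 2] leave a term linear in [tau] once the common
    factor is cancelled. *)
Lemma energy_dissipation_step (eps tau : R) u0 (U : nat -> V -> R) (s t : R) :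
  0 < eps -> 0 < tau < eps -> (forall i, 0 < degr w r i) ->
  tau * Lap_bound <= 2^-1 ->
  2 * (tau * Lap_bound) * (\sum_i degr w r i) * (\sum_i (degr w r i)^-1) <= 1 ->
  in01 u0 -> semi_discrete w r eps tau u0 U -> 0 <= s -> s <= t ->
  let us := U (absz (Num.ceil (s / tau))) in
  let ut := U (absz (Num.ceil (t / tau))) in
  (1 - tau / eps) * normV2 w r (fun i => us i - ut i) <=
  (t - s + tau) * (2 * (energy eps us - energy eps ut) +
    2 * (2 * (\sum_i degr w r i) * Lap_bound ^+ 2) * tau).
Proof.
move=> eps0 /andP[tau0 tau_eps] d0 small psd u01 sd s0 st.
have U01 m : in01 (U m).
  by case: sd => U0 US; case: m => [|m]; [rewrite U0|case: (US m)].
have ceilE x : 0 <= x ->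
    ((absz (Num.ceil (x / tau)))%:R : R) = (Num.ceil (x / tau))%:~R.
  move=> x0; rewrite natr_absz ger0_norm// ceil_ge0.
  by rewrite (lt_le_trans (ltrN10 _))// divr_ge0// ltW.
set m := absz _; set k := absz _ => /=.
have mk : (m <= k)%N.
  rewrite -(ler_nat R) !ceilE// ?(le_trans s0)// ler_int.
  by apply: le_ceil; rewrite ler_wpM2r// invr_ge0 ltW.
have [le1] := lyapunov_steps eps0 tau0 small d0 psd tau_eps u01 sd m (k - m)%N.
rewrite subnKC// => H; apply: (le_trans H); move: le1 {H}; rewrite subnKC//.
have := lyapunov_energy eps0 tau0 small (U01 m).
have := lyapunov_energy eps0 tau0 small (U01 k).
rewrite !ler_norml => /andP[Ek _] /andP[_ Em] le1.
(* Rounding up costs at most one extra step: [k * tau] exceeds [t] by at most [tau], while [m * tau]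
   is at least [s]. *)
have kt : (k - m)%:R * tau <= t - s + tau.
  rewrite natrB// mulrBl.
  have k1 : (k%:R : R) * tau <= t + tau.
    rewrite -ler_pdivlMr// mulrDl divff ?gt_eqF// ceilE ?(le_trans s0)//.
    have /andP[+ _] := ceil_itv (t / tau).
    by rewrite intrB => /ltW; rewrite lerBlDr.
  have m1 : s <= (m%:R : R) * tau.
    by rewrite -ler_pdivrMr// ceilE// ceil_ge.
  by lra.
rewrite -(ler_pM2l tau0) [tau * (_%:R * _)]mulrA [tau * _%:R]mulrC.
apply: (@le_trans _ _ ((t - s + tau) *
    (lyapunov eps tau (U m) - lyapunov eps tau (U k)))).
  by rewrite ler_wpM2r// subr_ge0.
rewrite mulrCA; apply: ler_wpM2l; first by lra.
by move: Ek Em; rewrite (expr2 tau); lra.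
Qed.

End Laplacian.

Theorem theorem45 (R : realType) (V : finType) (w : V -> V -> R) (r eps : R)
  (u0 : V -> R) (tau : nat -> R) (U : nat -> nat -> V -> R)
  (uhat : R -> V -> R) :
  simple_connected_weights w -> 0 <= r <= 1 -> 0 < eps ->
  in01 u0 -> u0 <> (fun _ => 0) -> u0 <> (fun _ => 1) ->
  (forall n, 0 < tau n < eps) -> (forall n, tau n.+1 <= tau n) ->
  tau @ \oo --> 0 ->
  (forall n, semi_discrete w r eps (tau n) u0 (U n)) ->
  (forall t, 0 <= t -> forall i,
     (fun n => U n (absz (Num.ceil (t / tau n))) i) @ \oo --> uhat t i) ->
  (exists gamma, AC_solution w r eps uhat gamma) ->
  uhat 0 = u0 ->
  (forall s t, 0 <= s -> s < t ->
     (GL w r eps (uhat s) - GL w r eps (uhat t) >=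
      ((2 * (t - s))^-1 * normV2 w r (fun i => uhat s i - uhat t i))%:E)%E) /\
  (forall s t, 0 <= s -> s <= t -> (GL w r eps (uhat t) <= GL w r eps (uhat s))%E).
Proof.
move=> [w_sym [w_ge0 [_ conn]]] _ eps0 u01 _ _ tau_eps _ tau0 sd Ucv.
move=> [gamma [du [_ [_ [uhat01 _]]]]] _.
have key s t : 0 <= s -> s < t -> normV2 w r (fun i => uhat s i - uhat t i) <=
    (t - s) * (2 * (energy w r eps (uhat s) - energy w r eps (uhat t))).
  move=> s0 st.
  have [d0|[i0 di0]] : (forall i, 0 < degr w r i) \/ exists i, degr w r i = 0.
    have [?|/existsNP[i di]] := pselect (forall i, 0 < degr w r i); first by left.
    right; exists i; apply/le_anti; rewrite degr_ge0 andbT leNgt; exact/negP.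
  - set b := Lap_bound w r; set D := \sum_i degr w r i.
    have lhs : (1 - tau n / eps) *
        normV2 w r (fun i => U n (absz (Num.ceil (s / tau n))) i -
                             U n (absz (Num.ceil (t / tau n))) i) @[n --> \oo] -->
        normV2 w r (fun i => uhat s i - uhat t i).
      rewrite -[X in _ --> X]mul1r; apply: cvgM.
        rewrite -[X in _ --> X]subr0; apply: cvgB; first exact: cvg_cst.
        by rewrite -(mul0r eps^-1); apply: cvgM => //; exact: cvg_cst.
      have Ud i : U n (absz (Num.ceil (s / tau n))) i -
          U n (absz (Num.ceil (t / tau n))) i @[n --> \oo] --> uhat s i - uhat t i.
        by apply: cvgB; apply: Ucv => //; apply: ltW; exact: le_lt_trans st.
      exact: cvg_ipV.
    have rhs : (t - s + tau n) *
        (2 * (energy w r eps (U n (absz (Num.ceil (s / tau n)))) -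
              energy w r eps (U n (absz (Num.ceil (t / tau n))))) +
         2 * (2 * D * b ^+ 2) * tau n) @[n --> \oo] -->
        (t - s) * (2 * (energy w r eps (uhat s) - energy w r eps (uhat t))).
      rewrite -[t - s in X in _ --> X]addr0; apply: cvgM.
        by apply: cvgD => //; exact: cvg_cst.
      rewrite -[2 * (_ - _) in X in _ --> X]addr0; apply: cvgD.
        apply: cvgM; first exact: cvg_cst.
        apply: cvgB; apply: cvg_energy; apply: Ucv => //.
        by apply: ltW; exact: le_lt_trans st.
      rewrite -(mulr0 (2 * (2 * D * b ^+ 2))).
      by apply: cvgM => //; exact: cvg_cst.
    have tau_b c : (fun n => tau n * c) @ \oo --> 0.
      by rewrite -(mul0r c); apply: cvgM => //; exact: cvg_cst.
    (* The smallness conditions on the time step hold for all large [n], which is enough to compare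
       the limits. *)
    have small1 : \forall n \near \oo, tau n * b < 2^-1.
      by apply: (cvgr_lt _ (tau_b b)); rewrite invr_gt0.
    have small2 : \forall n \near \oo,
        tau n * (2 * b * D * \sum_i (degr w r i)^-1) < 1.
      exact: (cvgr_lt _ (tau_b _)).
    apply: (ler_cvg_to lhs rhs); near=> n.
    apply: (energy_dissipation_step w_sym w_ge0 eps0 (tau_eps n) d0 _ _ u01 (sd n) s0 (ltW st)).
      by apply: ltW; near: n.
    rewrite (_ : _ * _ = tau n * (2 * b * D * \sum_i (degr w r i)^-1)).
      by apply: ltW; near: n.
    by rewrite /b /D; ring.
  (* A vertex of degree 0 is the only vertex: both sides vanish. *)
  - have d0 := degr_eq0_all w_ge0 conn di0.
    have ip0 u v : ipV w r u v = 0 by apply: big1 => i _; rewrite d0 mulr0.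
    by rewrite /normV2 /energy !ip0 !mulr0 addr0 subrr !mulr0.
have dissip s t : 0 <= s -> s < t ->
    ((2 * (t - s))^-1 * normV2 w r (fun i => uhat s i - uhat t i) <=
     energy w r eps (uhat s) - energy w r eps (uhat t)).
  move=> s0 st; rewrite ler_pdivrMl ?mulr_gt0 ?subr_gt0//.
  by rewrite -mulrA mulrCA key.
(* A solution takes values in [0,1], so [GL] is finite along it and the extended-real claims reduce
   to real ones. *)
have GLE t : 0 <= t -> GL w r eps (uhat t) = (energy w r eps (uhat t))%:E.
  by move=> t0; apply: GL_energy => //; exact: uhat01.
split=> s t s0 st.
  rewrite !GLE ?(le_trans s0 (ltW st))// -EFinB lee_fin; exact: dissip.
rewrite !GLE ?(le_trans s0 st)// lee_fin.
move: st; rewrite le_eqVlt => /orP[/eqP->//|st].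
rewrite -subr_ge0 (le_trans _ (dissip _ _ s0 st))// mulr_ge0 ?normV2_ge0//.
by rewrite invr_ge0 mulr_ge0// subr_ge0 ltW.
Unshelve. all: by end_near.
Qed.
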